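(* Let $F$ and $G$ be Hilbert spaces, let $A\colon F\to G$ be a bounded linear operator, let $g\in G$, let $\tau\ge 0$, and put $\varepsilon=\tau^2$. Let $J\colon F\to\mathbb{R}\cup\{+\infty\}$ be proper, convex, lower semicontinuous and coercive. Assume that $J$ is strictly convex along $\ker A$ and attains its minimum on $\ker A$ (in the sense given in the context). For $f\in F$ and $\lambda>0$ let $$L(f,\lambda)=J(f)+\lambda\left(\|Af-g\|^2-\varepsilon\right),$$ let $f_\lambda$ denote the unique minimizer of $L(\cdot,\lambda)$ over $F$, and let $D(\lambda)=\inf_{f\in F}L(f,\lambda)=L(f_\lambda,\lambda)$. Then $D$ is differentiable on $(0,\infty)$, and for every $\lambda>0$ its derivative is given by $$D'(\lambda)=\|Af_\lambda-g\|^2-\varepsilon.$$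
   Context: A function $J\colon F\to\mathbb{R}\cup\{+\infty\}$ is coercive if $J(f)\to\infty$ as $\|f\|\to\infty$. ''$J$ is strictly convex along $\ker A$'' means: for all $f\neq f'$ with $J(f),J(f')<\infty$ and $f-f'\in\ker A$, and all $t\in(0,1)$, one has $J(tf+(1-t)f')<tJ(f)+(1-t)J(f')$. ''$J$ attains its minimum on $\ker A$'' means: $J$ has a minimizer over $F$, and every minimizer of $J$ over $F$ belongs to $\ker A$. Under these assumptions, for every $\lambda>0$ the problem of minimizing $L(\cdot,\lambda)$ over $F$ has a unique solution, denoted $f_\lambda$. The function $D$ is called the dual function associated with the problem of minimizing $J(f)$ subject to $\|Af-g\|^2\le\varepsilon$. *)

(* Defs.v *)
From HB Require Import structures.
From mathcomp Require Import all_boot all_order all_algebra.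
From mathcomp Require Import all_classical all_reals all_analysis.

Set Implicit Arguments.
Unset Strict Implicit.
Unset Printing Implicit Defensive.

Import Order.TTheory GRing.Theory Num.Theory.
Import numFieldNormedType.Exports.

Local Open Scope classical_set_scope.
Local Open Scope ring_scope.

(* Real Hilbert spaces: [inner] is bilinear, symmetric and positive definite
   (that is what [{dot F for idfun}] says over a real scalar field), and the
   complete norm of [F] is the one it induces. *)
HB.mixin Record CompleteNormedModule_isHilbert (R : realType) F
    of CompleteNormedModule R F := {
  inner : {dot F for (@idfun R)} ;
  inner_normE : forall x : F, inner x x = `|x| ^+ 2
}.

#[short(type="hilbertType")]
HB.structure Definition Hilbert (R : realType) :=
  {F of CompleteNormedModule R F & CompleteNormedModule_isHilbert R F}.

Section extended_real_functions.
Context {R : realType} {F : normedModType R}.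
Implicit Types (J : F -> \bar R) (V : set F) (f : F).
Local Open Scope ereal_scope.

(* [J] takes its values in R `|` {+oo} and is not identically +oo. *)
Definition proper_function J :=
  (forall f, J f != -oo) /\ (exists f, J f < +oo).

(* The library's [convex_function] only covers real-valued functions. *)
Definition convex_efunction J := forall f f' (t : R), (0 < t < 1)%R ->
  J (t *: f + (1 - t) *: f')%R <= t%:E * J f + (1 - t)%:E * J f'.

Definition coercive J :=
  forall M : R, exists r : R, forall f, (r < `|f|)%R -> M%:E < J f.

Definition strictly_convex_along V J := forall f f',
  f != f' -> J f < +oo -> J f' < +oo -> V (f - f')%R ->
  forall t : R, (0 < t < 1)%R ->
  J (t *: f + (1 - t) *: f')%R < t%:E * J f + (1 - t)%:E * J f'.

Definition minimizer J f := forall f', J f <= J f'.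

Definition unique_minimizer J f :=
  minimizer J f /\ forall f', minimizer J f' -> f' = f.

Definition attains_min_on V J :=
  (exists f, minimizer J f) /\ (forall f, minimizer J f -> V f).

End extended_real_functions.

Definition ker {R : realType} {F G : normedModType R}
  (A : {linear F -> G}) : set F := [set f | A f = 0].

Section lagrangian.
Context {R : realType} {F G : normedModType R}.
Variables (J : F -> \bar R) (A : {linear F -> G}) (g : G) (eps : R).
Local Open Scope ereal_scope.

Definition lagrangian (f : F) (lam : R) : \bar R :=
  J f + (lam * (`|A f - g| ^+ 2 - eps))%:E.

Definition dual_function (lam : R) : \bar R :=
  ereal_inf (range (fun f => lagrangian f lam)).

End lagrangian.

(* Main.v *)
(** A minimizer exists because the sublevel sets of the Lagrangian are closed,
    convex and bounded, and a decreasing sequence of such sets has a common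
    point: by the parallelogram identity, almost-shortest vectors of the sets
    form a Cauchy sequence.

    With [q lam := `|A f_lam - g| ^+ 2 - eps], testing [D mu] with [f_lam] shows
    that [D] has supergradient [q lam] at [lam], so [D (lam + h) - D lam - h * q lam]
    lies between [h * (q (lam + h) - q lam)] and [0]. Comparing [f_lam] and
    [f_mu] with their midpoint bounds [`|A f_mu - A f_lam| ^+ 2] by
    [(2 / lam) * (lam - mu) * (q mu - q lam)], and since [q] is quadratic in [A f]
    this makes [q mu - q lam] of order [mu - lam]: the remainder is quadratic. *)

Require Import Defs.
From HB Require Import structures.
From mathcomp Require Import all_boot all_order all_algebra.
From mathcomp Require Import all_classical all_reals all_analysis.
From mathcomp Require Import ring lra.
Set Implicit Arguments.
Unset Strict Implicit.
Unset Printing Implicit Defensive.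
Import Order.TTheory GRing.Theory Num.Theory.
Import numFieldNormedType.Exports.
Local Open Scope classical_set_scope.
Local Open Scope ring_scope.

(** * Convexity and existence of minimizers in Hilbert spaces *)

Lemma hilbert_normsqr_convex (R : realType) (F : hilbertType R) (x y : F) (t : R) :
  `|t *: x + (1 - t) *: y| ^+ 2 =
  t * `|x| ^+ 2 + (1 - t) * `|y| ^+ 2 - t * (1 - t) * `|x - y| ^+ 2.
Proof.
have innerC (u v : F) : inner u v = inner v u by rewrite hermC /= expr0 mul1r.
have innerl a b u v w :
    inner (a *: u + b *: v) w = a * inner (u : F) w + b * inner (v : F) w :> R.
  by rewrite linearDl/= !linearZl_LR.
(* Writing [x - y] as [1 *: x + (-1) *: y] lets [innerl] expand it like the convex combination. *)
rewrite -[x - y](congr2 +%R (scale1r x) (scaleN1r y)) -!inner_normE.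
rewrite !innerl !(innerC _ (_ *: _ + _)) !innerl (innerC y x).
ring.
Qed.

(** Takes the place of weak compactness of bounded closed convex sets; closure under midpoints is
    all that the parallelogram identity asks for. *)
Lemma nested_closed_convex_nonempty (R : realType) (F : hilbertType R)
    (C : nat -> set F) (r : R) :
  (forall m n, (m <= n)%N -> C n `<=` C m) ->
  (forall n, closed (C n)) ->
  (forall n x y, C n x -> C n y -> C n (2^-1 *: x + (1 - 2^-1) *: y)) ->
  (forall n, C n !=set0) ->
  (forall x, C 0 x -> `|x| <= r) ->
  exists x, forall n, C n x.
Proof.
move=> Cdecr Cclosed Cmid Cne Cr.
pose S n := [set `|x| ^+ 2 | x in C n].
pose d n := inf (S n).
have S_inf n : has_inf (S n).
  split; first by have [x Cx] := Cne n; exists (`|x| ^+ 2), x.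
  by exists 0 => _ [x _ <-]; rewrite sqr_ge0.
have d_le n x : C n x -> d n <= `|x| ^+ 2.
  by move=> Cx; apply: ge_inf; [case: (S_inf n)|exists x].
have d_homo m n : (m <= n)%N -> d m <= d n.
  move=> mn; apply: lb_le_inf; first by case: (S_inf n).
  by move=> _ [x Cx <-]; apply: d_le; apply: Cdecr Cx.
have d_sup : has_sup (range d).
  split; first by exists (d 0), 0.
  exists (r ^+ 2) => _ [n _ <-]; have [x Cx] := Cne n.
  apply: le_trans (d_le _ _ Cx) _.
  have xr := Cr _ (Cdecr _ _ (leq0n n) _ Cx).
  by rewrite lerXn2r ?nnegrE ?(le_trans _ xr).
set s := sup (range d).
have d_les n : d n <= s by apply: ub_le_sup; [case: d_sup|exists n].
have /choice[x xP] n : exists x, C n x /\ `|x| ^+ 2 < d n + n.+1%:R^-1.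
  have [||_ [x Cx <-] xd] := @inf_adherent R (S n) n.+1%:R^-1.
  - by rewrite invr_gt0 ltr0n.
  - exact: S_inf.
  - by exists x.
have xcvg : cvg (x n @[n --> \oo]).
  apply/cauchy_cvgP/cauchy_exP => e e0.
  (* For [N] large, [d N > s - e ^+ 2 / 8], while the squared norms of [x N] and [x n] are below
     [s + e ^+ 2 / 8]. The midpoint has squared norm at least [d N], so a quarter of the squared
     distance is below [e ^+ 2 / 4]. *)
  have e'0 : 0 < e ^+ 2 / 8 by rewrite divr_gt0 ?exprn_gt0.
  have [_ [N1 _ <-] dN1] := sup_adherent e'0 d_sup.
  have [N2 _ NP] := near_infty_natSinv_lt (PosNum e'0).
  pose N := maxn N1 N2.
  exists (x N), N => // n /= Nn.
  rewrite -ball_normE /=.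
  have small k : (N <= k)%N -> `|x k| ^+ 2 < s + e ^+ 2 / 8.
    move=> Nk; apply: lt_trans (proj2 (xP k)) _.
    apply: ler_ltD; first exact: d_les.
    by apply: NP => /=; apply: leq_trans Nk; exact: leq_maxr.
  have sN := small _ (leqnn N); have sn := small _ Nn.
  have CNn := Cdecr _ _ Nn _ (proj1 (xP n)).
  have mid := d_le _ _ (Cmid N _ _ (proj1 (xP N)) CNn).
  rewrite hilbert_normsqr_convex in mid.
  have dN := d_homo _ _ (leq_maxl N1 N2 : (N1 <= N)%N).
  rewrite -(ltr_pXn2r (ltn0Sn 1)) ?nnegrE ?normr_ge0 ?ltW //.
  rewrite -/s in dN1.
  lra.
exists (lim (x n @[n --> \oo])) => n.
apply: (closed_cvg (C n)) xcvg; first exact: Cclosed.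
by exists n => // m /= nm; apply: Cdecr nm _ (proj1 (xP m)).
Qed.

Lemma convex_lsc_coercive_minimizer (R : realType) (F : hilbertType R)
    (J : F -> \bar R) :
  proper_function J -> convex_efunction J -> lower_semicontinuous J ->
  coercive J -> exists f, minimizer J f.
Proof.
move=> [_ [f0 f0fin]] Jconvex /lower_semicontinuousP Jlsc Jcoercive.
set i := ereal_inf (range J).
have i_le f : (i <= J f)%E by apply: ereal_inf_lbound; exists f.
(* Real levels decreasing to the infimum [i], strictly above it so that every sublevel set is
   nonempty. At this stage [i] may still be [-oo], hence two choices of [a]. *)
have [a [adecr ia ai]] : exists a : nat -> R, [/\
    forall m n, (m <= n)%N -> a n <= a m,
    forall n, (i < (a n)%:E)%E &
    forall y, (forall n, (y <= (a n)%:E)%E) -> (y <= i)%E].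
  have : (i < +oo)%E by apply: le_lt_trans f0fin.
  case: i {i_le} => [r| |] // _.
    exists (fun n => r + n.+1%:R^-1); split.
    - by move=> m n mn; rewrite lerD2l lef_pV2 ?posrE ?ltr0n // ler_nat.
    - by move=> n; rewrite lte_fin ltrDl invr_gt0 ltr0n.
    - move=> y yle; apply/lee_addgt0Pr => e e0.
      have [N _ NP] := near_infty_natSinv_lt (PosNum e0).
      apply: le_trans (yle N) _; rewrite -EFinD lee_fin lerD2l ltW //.
      exact: (NP N (leqnn N)).
  exists (fun n => - n%:R); split => //.
  - by move=> m n mn; rewrite lerN2 ler_nat.
  - by move=> n; rewrite ltNyr.
  - case=> [y|/(_ 0)|] // yle.
    have := yle (Num.truncn `|y|).+1; rewrite lee_fin lerNr => h.
    have := truncnS_gt `|y|; rewrite ltNge => /negP[].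
    by apply: le_trans h _; rewrite -normrN ler_norm.
pose C n := [set f | (J f <= (a n)%:E)%E].
have [r Jr] := Jcoercive (a 0).
have [|||||f Cf] := @nested_closed_convex_nonempty R F C r.
- by move=> m n mn f /= /le_trans; apply; rewrite lee_fin adecr.
- move=> n; rewrite -[C n]setCK; apply: open_closedC.
  rewrite (_ : ~` C n = [set f | ((a n)%:E < J f)%E]); first exact: Jlsc.
  by apply/seteqP; split=> f /=; rewrite ltNge => /negP.
- move=> n x y /= Cx Cy.
  have t01 : 0 < (2^-1 : R) < 1 by apply/andP; split; lra.
  apply: le_trans (Jconvex _ _ _ t01) _.
  rewrite [leRHS](_ : _ = (2^-1)%:E * (a n)%:E + (1 - 2^-1)%:E * (a n)%:E)%E.
    by rewrite leeD // lee_wpmul2l // lee_fin; lra.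
  by rewrite -!EFinM -EFinD; congr EFin; ring.
- move=> n; have /ereal_inf_lt[_ [f _ <-] /ltW] := ia n; by exists f.
- move=> f; apply: contraPT; rewrite -ltNge => /Jr Jf /=.
  by apply/negP; rewrite -ltNge.
by exists f => f'; apply: le_trans (i_le f'); exact: ai.
Qed.

Lemma is_derive_of_quadratic_bound (R : realType) (f : R -> R) (x l K d : R) :
  0 < d ->
  (forall h, `|h| < d -> `|f (x + h) - f x - h * l| <= K * h ^+ 2) ->
  is_derive x 1 f l.
Proof.
move=> d0 fK.
suff cvgl : h^-1 *: (f (h *: 1 + x) - f x) @[h --> 0^'] --> l.
  by apply: DeriveDef; [apply/cvg_ex; exists l | exact: cvg_lim].
apply/cvgrPdist_le => e e0 /=.
(* The difference quotient misses [l] by at most [K] times the modulus of [h]; adding 1 keeps the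
   divisor in the radius positive. *)
have K0 : 0 < `|K| + 1 by rewrite ltr_wpDl.
have m0 : 0 < Num.min d (e / (`|K| + 1)) by rewrite lt_min d0 divr_gt0.
exists (Num.min d (e / (`|K| + 1))) => //= h /=.
rewrite sub0r normrN lt_min => /andP[hd he] h0.
have -> : l - h^-1 *: (f (h *: 1 + x) - f x) =
    - (h^-1 * (f (x + h) - f x - h * l)).
  rewrite scaler1 (addrC h) /GRing.scale /=.
  by field.
rewrite normrN normrM normfV ler_pdivrMl ?normr_gt0 //.
apply: le_trans (fK _ hd) _.
have -> : h ^+ 2 = `|h| ^+ 2 by rewrite real_normK ?num_real.
rewrite ltr_pdivlMr // in he.
have := ler_norm K; have := normr_ge0 h.
nra.
Qed.

(** * Semicontinuity, coercivity and convexity of the Lagrangian *)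

Lemma lagrangian_lsc (R : realType) (F G : normedModType R)
    (J : F -> \bar R) (A : {linear F -> G}) (g : G) (eps lam : R) :
  continuous A -> lower_semicontinuous J ->
  lower_semicontinuous (fun f => lagrangian J A g eps f lam).
Proof.
move=> Acont Jlsc f a aL.
pose c (x : F) := lam * (`|A x - g| ^+ 2 - eps).
have ccont : c x @[x --> f] --> c f.
  apply: cvgM; first exact: cvg_cst.
  apply: cvgB; last exact: cvg_cst.
  have ncont : `|A x - g| @[x --> f] --> `|A f - g|.
    by apply: cvg_norm; apply: cvgB; [exact: Acont|exact: cvg_cst].
  by under eq_fun do rewrite expr2; rewrite expr2; exact: cvgM.
have acJ : ((a - c f)%:E < J f)%E by rewrite EFinB lteBlDr.
(* A real [b] strictly between [a - c f] and [J f] splits the task: near [f], [J] stays above [b] by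
   semicontinuity and [c] above [a - b] by continuity. *)
have [b [acb bJ]] : exists b : R, a - c f < b /\ (b%:E < J f)%E.
  case: (J f) acJ => [j| |] //.
    rewrite lte_fin => /midf_lt[? ?]; exists ((a - c f + j) / 2).
    by rewrite lte_fin.
  by move=> _; exists (a - c f + 1); rewrite ltrDl ltr01 ltry.
have [V fV bV] := Jlsc f b bJ.
exists (V `&` [set x | a - b < c x]).
  apply: filterI => //; apply: (cvgr_gt (c f)) => //.
  by rewrite ltrBlDr -ltrBlDl.
move=> x [/bV bJx /= abx].
rewrite /lagrangian -lteBlDr // -EFinB; apply: lt_trans bJx.
by rewrite lte_fin -/(c x) ltrBlDr -ltrBlDl.
Qed.

Lemma lagrangian_coercive (R : realType) (F G : normedModType R)
    (J : F -> \bar R) (A : {linear F -> G}) (g : G) (eps lam : R) :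
  0 <= lam -> coercive J -> coercive (fun f => lagrangian J A g eps f lam).
Proof.
move=> lam0 Jcoercive M; have [r Jr] := Jcoercive (M + lam * eps).
exists r => f /Jr JM; rewrite /lagrangian -lteBlDr // -EFinB.
apply: le_lt_trans JM; rewrite lee_fin.
have := mulr_ge0 lam0 (sqr_ge0 `|A f - g|); lra.
Qed.

Lemma lagrangian_proper (R : realType) (F G : normedModType R)
    (J : F -> \bar R) (A : {linear F -> G}) (g : G) (eps lam : R) :
  proper_function J -> proper_function (fun f => lagrangian J A g eps f lam).
Proof.
move=> [JNy [f0 Jf0]]; split=> [f|].
  by rewrite /lagrangian; case: (J f) (JNy f).
by exists f0; rewrite /lagrangian; case: (J f0) Jf0 => [j| |] // _; rewrite ?ltry.
Qed.

(** [J] contributes plain convexity, the quadratic term its exact defect from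
    [hilbert_normsqr_convex]. Convexity, uniqueness and stability of minimizers all come from this
    defect. *)
Lemma lagrangian_convex_gap (R : realType) (F : normedModType R)
    (G : hilbertType R) (J : F -> \bar R) (A : {linear F -> G}) (g : G)
    (eps lam : R) (f f' : F) (t : R) :
  proper_function J -> convex_efunction J -> 0 < t < 1 ->
  (lagrangian J A g eps (t *: f + (1 - t) *: f')%R lam <=
   t%:E * lagrangian J A g eps f lam + (1 - t)%:E * lagrangian J A g eps f' lam
   - (lam * (t * (1 - t) * `|A f - A f'| ^+ 2))%:E)%E.
Proof.
move=> [JNy _] Jconvex t01; have /andP[t0 t1] := t01.
have u0 : 0 < 1 - t by lra.
have := Jconvex f f' _ t01.
rewrite /lagrangian linearD !linearZ/=.
have -> : t *: A f + (1 - t) *: A f' - g =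
    t *: (A f - g) + (1 - t) *: (A f' - g).
  by rewrite !scalerBr addrACA -opprD -scalerDl (addrC t) subrK scale1r.
have -> : A f - A f' = (A f - g) - (A f' - g) by rewrite opprB addrA subrK.
rewrite hilbert_normsqr_convex.
move: (JNy f) (JNy f').
have tE : (0 < t%:E)%E by rewrite lte_fin.
have uE : (0 < (1 - t)%:E)%E by rewrite lte_fin.
case: (J f) => [j| |] //; case: (J f') => [j'| |] // _ _ Jmid.
- apply: le_trans (leeD Jmid (lexx _)) _.
  by rewrite -!EFinM -!EFinD lee_fin; lra.
(* Both weights are positive, so an infinite value of [J] makes the right-hand side [+oo]. *)
- by rewrite addye // gt0_muley // leey.
- by rewrite addye // gt0_muley // leey.
- by rewrite !addye // !gt0_muley // leey.
Qed.

Lemma lagrangian_convex (R : realType) (F : normedModType R)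
    (G : hilbertType R) (J : F -> \bar R) (A : {linear F -> G}) (g : G)
    (eps lam : R) :
  0 <= lam -> proper_function J -> convex_efunction J ->
  convex_efunction (fun f => lagrangian J A g eps f lam).
Proof.
move=> lam0 Jproper Jconvex f f' t t01.
apply: le_trans (lagrangian_convex_gap A g eps lam f f' Jproper Jconvex t01) _.
have /andP[t0 t1] := t01.
by rewrite geeDl // lee_fin oppr_le0 !mulr_ge0 ?subr_ge0 // ltW.
Qed.

(** * Minimizers of the Lagrangian: uniqueness and dependence on the multiplier *)

Lemma lagrangian_minimizer_fin (R : realType) (F G : normedModType R)
    (J : F -> \bar R) (A : {linear F -> G}) (g : G) (eps lam : R) (f : F) :
  proper_function J -> minimizer (fun f => lagrangian J A g eps f lam) f ->
  exists j, J f = j%:E.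
Proof.
move=> [JNy [f0 Jf0]] /(_ f0); rewrite /lagrangian.
case: (J f) (JNy f) => [j| |] // _; first by exists j.
by case: (J f0) Jf0.
Qed.

Lemma dual_function_minimizer (R : realType) (F G : normedModType R)
    (J : F -> \bar R) (A : {linear F -> G}) (g : G) (eps lam : R) (f : F) :
  minimizer (fun f => lagrangian J A g eps f lam) f ->
  dual_function J A g eps lam = lagrangian J A g eps f lam.
Proof.
move=> fmin; apply/eqP; rewrite eq_le; apply/andP; split.
  by apply: ereal_inf_lbound; exists f.
by apply: le_ereal_inf_tmp => _ [f' _ <-]; exact: fmin.
Qed.

(** The midpoint of two distinct minimizers would do better: if [A f = A f'], the quadratic terms
    agree and strict convexity of [J] along [ker A] applies; otherwise the convexity gap is
    positive. *)
Lemma lagrangian_minimizer_unique (R : realType) (F : normedModType R)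
    (G : hilbertType R) (J : F -> \bar R) (A : {linear F -> G}) (g : G)
    (eps lam : R) (f f' : F) :
  0 < lam -> proper_function J -> convex_efunction J ->
  strictly_convex_along (ker A) J ->
  minimizer (fun f => lagrangian J A g eps f lam) f ->
  minimizer (fun f => lagrangian J A g eps f lam) f' -> f = f'.
Proof.
move=> lam0 Jproper Jconvex Jstrict fmin f'min.
have [j Jf] := lagrangian_minimizer_fin Jproper fmin.
have [j' Jf'] := lagrangian_minimizer_fin Jproper f'min.
have t01 : 0 < (2^-1 : R) < 1 by apply/andP; split; lra.
have ff' := f'min f; have f'f := fmin f'.
have midf := fmin (2^-1 *: f + (1 - 2^-1) *: f').
apply/eqP; apply/negPn/negP => neq_ff'.
case: (eqVneq (A f) (A f')) => [AfE|Aff'].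
  have kerff' : ker A (f - f') by rewrite /ker /= linearB AfE subrr.
  have := Jstrict f f' neq_ff' _ _ kerff' _ t01.
  rewrite Jf Jf' !ltry => /(_ isT isT).
  move: midf ff' f'f.
  rewrite /lagrangian linearD !linearZ/= -AfE -scalerDl (addrC 2^-1) subrK.
  rewrite scale1r Jf Jf'.
  case: (J (_ *: f + _)) => [m| |] //.
    by rewrite -!EFinM -!EFinD !lee_fin lte_fin; lra.
have := lagrangian_convex_gap A g eps lam f f' Jproper Jconvex t01.
apply/negP; rewrite -ltNge; apply: lt_le_trans midf.
move: ff' f'f; rewrite /lagrangian Jf Jf' -!EFinM -!EFinD !lee_fin lte_fin.
have : 0 < lam * (2^-1 * (1 - 2^-1) * `|A f - A f'| ^+ 2).
  by rewrite !mulr_gt0 ?exprn_gt0 ?normr_gt0 ?subr_eq0 //; lra.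
lra.
Qed.

(** Minimality of [f] against the midpoint bounds the left-hand side by the excess of the
    [lam]-Lagrangian at [f'] over [f]. For [mu] that excess is nonpositive, and passing from [mu] to
    [lam] changes it by the right-hand side. *)
Lemma lagrangian_minimizer_gap (R : realType) (F : normedModType R)
    (G : hilbertType R) (J : F -> \bar R) (A : {linear F -> G}) (g : G)
    (eps lam mu : R) (f f' : F) :
  proper_function J -> convex_efunction J ->
  minimizer (fun f => lagrangian J A g eps f lam) f ->
  minimizer (fun f => lagrangian J A g eps f mu) f' ->
  lam / 2 * `|A f' - A f| ^+ 2 <=
  (lam - mu) * (`|A f' - g| ^+ 2 - `|A f - g| ^+ 2).
Proof.
move=> Jproper Jconvex fmin f'min.
have [j Jf] := lagrangian_minimizer_fin Jproper fmin.
have [j' Jf'] := lagrangian_minimizer_fin Jproper f'min.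
have t01 : 0 < (2^-1 : R) < 1 by apply/andP; split; lra.
have := le_trans (fmin _)
  (lagrangian_convex_gap A g eps lam f' f Jproper Jconvex t01).
have := f'min f.
rewrite /lagrangian Jf Jf' -!EFinM -!EFinD !lee_fin.
lra.
Qed.

Lemma lagrangian_minimizer_lipschitz (R : realType) (F : normedModType R)
    (G : hilbertType R) (J : F -> \bar R) (A : {linear F -> G}) (g : G)
    (eps lam mu : R) (f f' : F) :
  proper_function J -> convex_efunction J -> 0 < lam -> `|mu - lam| <= lam / 4 ->
  minimizer (fun f => lagrangian J A g eps f lam) f ->
  minimizer (fun f => lagrangian J A g eps f mu) f' ->
  `| `|A f' - g| ^+ 2 - `|A f - g| ^+ 2 | <=
  32 * `|A f - g| ^+ 2 / lam * `|mu - lam|.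
Proof.
move=> Jproper Jconvex lam0 mulam fmin f'min.
have := lagrangian_minimizer_gap Jproper Jconvex fmin f'min.
set a := `|A f - g|; set b := `|A f' - g|; set w := `|A f' - A f| => gap.
have a0 : 0 <= a by exact: normr_ge0.
have w0 : 0 <= w by exact: normr_ge0.
have b0 : 0 <= b by exact: normr_ge0.
have baw : b <= a + w.
  rewrite /b (_ : A f' - g = (A f - g) + (A f' - A f)) ?ler_normD //.
  by rewrite [RHS]addrC addrA subrK.
have abw : a <= b + w.
  rewrite /a (_ : A f - g = (A f' - g) - (A f' - A f)) ?ler_normB //.
  by rewrite opprB [RHS]addrC addrA subrK.
have Dab : `|b ^+ 2 - a ^+ 2| <= w * (2 * a + w).
  by rewrite ler_norml; apply/andP; split; nra.
have gap' : lam / 2 * w ^+ 2 <= `|mu - lam| * (w * (2 * a + w)).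
  apply: le_trans gap _; apply: le_trans (ler_norm _) _.
  by rewrite normrM distrC ler_wpM2l.
(* After division by [w], the bound [lam / 4] on the modulus of [mu - lam] absorbs the term in [w]
   on the right into half of the left-hand side. *)
have wle : lam * w <= 8 * a * `|mu - lam|.
  case: (ltrP 0 w) => [w_gt0|wle0].
    have : lam / 2 * w <= `|mu - lam| * (2 * a + w).
      by rewrite -(ler_pM2r w_gt0); lra.
    have : `|mu - lam| * w <= lam / 4 * w by rewrite ler_wpM2r.
    lra.
  have -> : w = 0 by lra.
  by rewrite mulr0 !mulr_ge0.
have w2a : w <= 2 * a.
  by rewrite -(ler_pM2l lam0); nra.
apply: le_trans Dab _.
rewrite mulrAC ler_pdivlMr //.
(* The constant 32 is 8 from [wle] times 4 from [2 * a + w <= 4 * a]. *)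
have : lam * w * (2 * a + w) <= 8 * a * `|mu - lam| * (4 * a).
  by apply: ler_pM wle _; rewrite ?(mulr_ge0 (ltW lam0)) //; lra.
lra.
Qed.

(** * Differentiability of the dual function *)

Theorem proposition6 (R : realType) (F G : hilbertType R)
  (A : {linear F -> G}) (hA : bounded_near A (nbhs (0 : F)))
  (g : G) (tau eps : R) (htau : 0 <= tau) (heps : eps = tau ^+ 2)
  (J : F -> \bar R)
  (hproper : proper_function J)
  (hconvex : convex_efunction J)
  (hlsc : lower_semicontinuous J)
  (hcoercive : coercive J)
  (hstrict : strictly_convex_along (ker A) J)
  (hmin : attains_min_on (ker A) J) :
  exists f_ : R -> F, forall lam : R, 0 < lam ->
    [/\ unique_minimizer (fun f => lagrangian J A g eps f lam) (f_ lam),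
        dual_function J A g eps lam = lagrangian J A g eps (f_ lam) lam,
        dual_function J A g eps lam \is a fin_num &
        is_derive lam 1 (fun x : R => fine (dual_function J A g eps x))
          (`|A (f_ lam) - g| ^+ 2 - eps)].
Proof.
have Acont : continuous A by apply/linear_bounded_continuous.
have /choice[f_ f_min] (lam : R) : exists f,
    0 < lam -> minimizer (fun f => lagrangian J A g eps f lam) f.
  (* [f_] must be total; its value [0] at [lam <= 0] is a placeholder. *)
  have [lam0|lam0] := ltrP 0 lam; last by exists 0.
  have [||||f fmin] :=
    @convex_lsc_coercive_minimizer R F (fun f => lagrangian J A g eps f lam).
  - exact: lagrangian_proper.
  - by apply: lagrangian_convex => //; exact: ltW.
  - exact: lagrangian_lsc.
  - by apply: lagrangian_coercive => //; exact: ltW.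
  by exists f.
have /choice[j jE] (lam : R) : exists j, 0 < lam -> J (f_ lam) = j%:E.
  have [lam0|lam0] := ltrP 0 lam; last by exists 0.
  by have [j jE] := lagrangian_minimizer_fin hproper (f_min _ lam0); exists j.
pose q lam := `|A (f_ lam) - g| ^+ 2 - eps.
have dualE lam : 0 < lam -> dual_function J A g eps lam = (j lam + lam * q lam)%:E.
  move=> lam0; rewrite (dual_function_minimizer (f_min _ lam0)).
  by rewrite /lagrangian jE.
have dual_le lam mu : 0 < lam -> 0 < mu ->
    j mu + mu * q mu <= j lam + mu * q lam.
  move=> lam0 mu0; have := f_min _ mu0 (f_ lam).
  by rewrite /lagrangian !jE.
exists f_ => lam lam0; split.
- split=> [|f fmin]; first exact: f_min.
  exact: lagrangian_minimizer_unique lam0 hproper hconvex hstrict fmin (f_min _ lam0).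
- exact: dual_function_minimizer (f_min _ lam0).
- by rewrite dualE.
(* The radius [lam / 4] keeps [lam + h] positive and is the range of the Lipschitz estimate. *)
have lam4 : 0 < lam / 4 by lra.
apply: (is_derive_of_quadratic_bound
  (K := 32 * `|A (f_ lam) - g| ^+ 2 / lam) lam4) => h hlam.
have mu0 : 0 < lam + h by move: hlam; rewrite ltr_norml => /andP[]; lra.
rewrite !dualE //= -/(q lam).
have mulam : `|lam + h - lam| <= lam / 4 by rewrite addrAC subrr add0r ltW.
have := lagrangian_minimizer_lipschitz hproper hconvex lam0 mulam
  (f_min _ lam0) (f_min _ mu0).
rewrite (addrAC lam) subrr add0r.
set K := 32 * _ / _ => qlip.
have {qlip}: `|h * (q (lam + h) - q lam)| <= K * h ^+ 2.
  rewrite normrM mulrC -real_normK ?num_real // expr2 mulrA.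
  rewrite ler_wpM2r //.
  rewrite (_ : q _ - q _ =
    `|A (f_ (lam + h)) - g| ^+ 2 - `|A (f_ lam) - g| ^+ 2) // /q.
  by ring.
(* Testing at [lam + h] with [f_ lam] makes the remainder nonpositive; testing at [lam] with
   [f_ (lam + h)] bounds it below by [h * (q (lam + h) - q lam)]. *)
have := dual_le _ _ lam0 mu0; have := dual_le _ _ mu0 lam0.
rewrite !ler_norml => ? ? /andP[? ?]; apply/andP; split; lra.
Qed.
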